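(* Let $\mathbb{T}$ be a time scale and let $a,b\in\mathbb{T}$ with $a<b$. Let $p\in C_{rd}([a,b]_{\mathbb{T}})$ with $p(t)\geq 0$ for all $t\in[a,b]_{\mathbb{T}}$, let $g:[a,b]_{\mathbb{T}}\to\mathbb{R}$ be non-decreasing on $[a,b]_{\mathbb{T}}$, and let $f_1,f_2\in C_{rd}([a,b]_{\mathbb{T}})$. If $f_1,f_2$ are similarly ordered, i.e. $(f_1(t)-f_1(s))(f_2(t)-f_2(s))\geq 0$ for all $t,s\in[a,b]_{\mathbb{T}}$, then $$\int_a^b p(t)\,\Delta g(t)\int_a^b p(t)f_1(t)f_2(t)\,\Delta g(t)\;\geq\;\int_a^b p(t)f_1(t)\,\Delta g(t)\int_a^b p(t)f_2(t)\,\Delta g(t).$$ If $f_1,f_2$ are oppositely ordered, i.e. $(f_1(t)-f_1(s))(f_2(t)-f_2(s))\leq 0$ for all $t,s\in[a,b]_{\mathbb{T}}$, then the inequality holds with $\leq$ in place of $\geq$.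
   Context: A time scale $\mathbb{T}$ is a nonempty closed subset of $\mathbb{R}$, and $[a,b]_{\mathbb{T}}:=[a,b]\cap\mathbb{T}$, $[a,b)_{\mathbb{T}}:=[a,b)\cap\mathbb{T}$. A function on a time scale is rd-continuous if it is continuous at every right-dense point and has finite left-sided limits at every left-dense point; $C_{rd}([a,b]_{\mathbb{T}})$ is the set of real-valued rd-continuous functions on $[a,b]_{\mathbb{T}}$. Riemann--Stieltjes $\Delta$-integral: let $f,g$ be bounded real-valued functions on $[a,b]_{\mathbb{T}}$ with $g$ non-decreasing on $[a,b]_{\mathbb{T}}$. A partition of $[a,b]_{\mathbb{T}}$ is a finite set $P=\{t_0,\dots,t_n\}\subset[a,b]_{\mathbb{T}}$ with $a=t_0<t_1<\dots<t_n=b$; a partition $P\supset P^*$ is called a refinement of $P^*$. For a selection $X=\{x_1,\dots,x_n\}$ with $x_i\in[t_{i-1},t_i)_{\mathbb{T}}$ put $S_g(f,P,X)=\sum_{i=1}^n f(x_i)(g(t_i)-g(t_{i-1}))$. Then $f$ is Riemann--Stieltjes $\Delta$-integrable with respect to $g$ on $[a,b]_{\mathbb{T}}$ if there is a number $\mathcal{I}\in\mathbb{R}$ such that for every $\varepsilon>0$ there is a partition $P^*$ with $|S_g(f,P,X)-\mathcal{I}|<\varepsilon$ for all refinements $P\supset P^*$ and all selections $X$ for $P$; this (unique) number is denoted $\int_a^b f(t)\,\Delta g(t)=\mathcal{I}$. *)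

(* Defs.v *)
From mathcomp Require Import all_boot all_order all_algebra.
From mathcomp Require Import all_classical all_reals all_analysis.

Set Implicit Arguments.
Unset Strict Implicit.
Unset Printing Implicit Defensive.

Import Order.TTheory GRing.Theory Num.Theory.
Import numFieldNormedType.Exports.

Local Open Scope classical_set_scope.
Local Open Scope ring_scope.

Definition time_scale (R : realType) (T : set R) : Prop :=
  T !=set0 /\ closed T.

Definition ts_itv (R : realType) (T : set R) (a b : R) : set R :=
  [set t | a <= t <= b] `&` T.

(* The jump operators are only meaningful where the set is nonempty; density
   below carries this condition explicitly (it says t < sup T, resp.
   inf T < t), so the usual conventions at the endpoints are not needed. *)
Definition forward_jump (R : realType) (T : set R) (t : R) : R :=
  inf (T `&` [set s | t < s]).

Definition backward_jump (R : realType) (T : set R) (t : R) : R :=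
  sup (T `&` [set s | s < t]).

Definition right_dense (R : realType) (T : set R) (t : R) : Prop :=
  [/\ T t, T `&` [set s | t < s] !=set0 & forward_jump T t = t].

Definition left_dense (R : realType) (T : set R) (t : R) : Prop :=
  [/\ T t, T `&` [set s | s < t] !=set0 & backward_jump T t = t].

(* Functions on a time scale T are total functions R -> R of which only the
   values on T are used: limits are taken along T. *)
Definition rd_continuous (R : realType) (T : set R) (f : R -> R) : Prop :=
  (forall t, right_dense T t -> f @ within T (nbhs t) --> f t) /\
  (forall t, left_dense T t -> exists l : R, f @ within T (t^'-) --> l).

(* As in the library's itv_partition, the list P is t_1, ..., t_n, the point
   t_0 = a being implicit; t_i is then nth b (a :: P) i. *)
Definition ts_partition (R : realType) (T : set R) (a b : R) (P : seq R) :
    Prop :=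
  itv_partition a b P /\ (forall t, t \in P -> ts_itv T a b t).

(* x i is the point selected in [t_i, t_(i+1)) for i = 0, ..., n - 1. *)
Definition selection (R : realType) (T : set R) (a b : R) (P : seq R)
    (x : nat -> R) : Prop :=
  forall i, (i < size P)%N ->
    nth b (a :: P) i <= x i < nth b (a :: P) i.+1 /\ T (x i).

Definition RS_sum (R : realType) (a b : R) (f g : R -> R) (P : seq R)
    (x : nat -> R) : R :=
  \sum_(0 <= i < size P)
    f (x i) * (g (nth b (a :: P) i.+1) - g (nth b (a :: P) i)).

Definition is_RS_delta_integral (R : realType) (T : set R) (a b : R)
    (f g : R -> R) (I : R) : Prop :=
  forall e : R, 0 < e ->
    exists2 P0 : seq R, ts_partition T a b P0 &
      forall P : seq R, ts_partition T a b P -> {subset P0 <= P} ->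
        forall x : nat -> R, selection T a b P x ->
          `|RS_sum a b f g P x - I| < e.

Definition nondecreasing_on (R : realType) (A : set R) (g : R -> R) : Prop :=
  {in A &, {homo g : s t / s <= t}}.

Definition RS_delta_integrable (R : realType) (T : set R) (a b : R)
    (f g : R -> R) : Prop :=
  [/\ [bounded f t | t in ts_itv T a b],
      [bounded g t | t in ts_itv T a b],
      nondecreasing_on (ts_itv T a b) g &
      exists I : R, is_RS_delta_integral T a b f g I].

(* Meaningful when RS_delta_integrable T a b f g, in which case the chosen
   number is unique. *)
Definition RS_delta_integral (R : realType) (T : set R) (a b : R)
    (f g : R -> R) : R :=
  get [set I : R | is_RS_delta_integral T a b f g I].

Definition similarly_ordered (R : realType) (A : set R) (f1 f2 : R -> R) :
    Prop :=
  forall t s, A t -> A s -> 0 <= (f1 t - f1 s) * (f2 t - f2 s).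

Definition oppositely_ordered (R : realType) (A : set R) (f1 f2 : R -> R) :
    Prop :=
  forall t s, A t -> A s -> (f1 t - f1 s) * (f2 t - f2 s) <= 0.

(* Main.v *)
Require Import Defs.
From mathcomp Require Import all_boot all_order all_algebra.
From mathcomp Require Import all_classical all_reals all_analysis.
From mathcomp Require Import ring lra.

Set Implicit Arguments.
Unset Strict Implicit.
Unset Printing Implicit Defensive.

Import Order.TTheory GRing.Theory Num.Theory.
Import numFieldNormedType.Exports.

Local Open Scope classical_set_scope.
Local Open Scope ring_scope.

(** Both inequalities pass to the limit from finite sums.  For one and the same
partition and selection, the four Riemann-Stieltjes sums are weighted sums with
weights [w_i = p (x_i) (g t_(i+1) - g t_i) >= 0], and Chebyshev's identity
writes twice the difference of the two sides as the double sum of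
[w_i w_j (f1 x_i - f1 x_j) (f2 x_i - f2 x_j)], whose terms all have the sign
prescribed by the ordering hypothesis ([chebyshev_sum]).  To take limits of
several sums along the same partitions and selections, the integral is recast
as the limit along a filter on pairs (partition, selection)
([RS_delta_integral_cvgP]).

The substantial part is that the integrals exist.  The indicator of [[t, oo[]
with [t] in the time scale is integrable because its sums telescope to
[g b - g t] as soon as [t] is a node ([RS_sum_step]).  On the points of the
time scale in [[a, b[], an rd-continuous function is within any given [e > 0] of
a linear combination of such indicators ([rd_continuous_approx]): near each point it varies little on the
right of the point, and little on the left of it, and these local step functions
are glued by induction along the time scale ([ts_itv_induction]).  Functions that
differ by at most [e] on [[a, b[] have sums that differ by at most
[e (g b - g a)], so the sums of an rd-continuous function form a Cauchy filter
([rd_continuous_RS_integrable]).  The half-open selection intervals are what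
makes this work for every non-decreasing [g], continuous or not: left limits
of the integrand need not be values. *)

(** * Partitions of the time-scale interval *)

Lemma itv_partition_sort (R : realType) (a b : R) (L : seq R) :
  (forall t, t \in L -> a < t <= b) -> b \in L ->
  itv_partition a b (sort <=%R (undup L)).
Proof.
move=> Lab bL; set s := sort _ _.
have s_mem t : (t \in s) = (t \in L) by rewrite mem_sort mem_undup.
have s_sorted : sorted <%R s by rewrite sort_lt_sorted undup_uniq.
split.
  rewrite path_sortedE ?s_sorted ?andbT; last exact: lt_trans.
  by apply/allP => t; rewrite s_mem => /Lab /andP[].
have bs : b \in s by rewrite s_mem.
have [s1 [s2 def_s]] : exists s1 s2, s = s1 ++ b :: s2.
  by clearbody s; case/splitPr: bs => s1 s2; exists s1, s2.
case: s2 def_s => [|t s2] def_s; first by rewrite def_s last_cat.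
have /Lab/andP[_ tb] : t \in L by rewrite -s_mem def_s mem_cat !inE eqxx !orbT.
by move: s_sorted; rewrite def_s => /cat_sorted2[_ /= /andP[/lt_geF]]; rewrite tb.
Qed.

Lemma ts_partition_sort (R : realType) (T : set R) (a b : R) (L : seq R) :
  (forall t, t \in L -> ts_itv T a b t /\ a < t) -> b \in L ->
  ts_partition T a b (sort <=%R (undup L)).
Proof.
move=> LS bL; split.
  by apply: itv_partition_sort => // t /LS[[/= /andP[_ ->] _] ->].
by move=> t; rewrite mem_sort mem_undup => /LS[].
Qed.

Lemma ts_partition_gt (R : realType) (T : set R) (a b : R) (P : seq R) t :
  ts_partition T a b P -> t \in P -> a < t.
Proof.
move=> [[+ _] _]; rewrite path_sortedE; last exact: lt_trans.
by case/andP => /allP aP _ /aP.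
Qed.

Lemma ts_partition_mem_end (R : realType) (T : set R) (a b : R) (P : seq R) :
  a < b -> ts_partition T a b P -> b \in P.
Proof.
move=> ab [[_ Pb] _]; case: P Pb => /= [/eqP ab'|t P /eqP <-].
  by move: ab; rewrite ab' ltxx.
exact: mem_last.
Qed.

Lemma ts_partition_node (R : realType) (T : set R) (a b : R) (P : seq R) i :
  T a -> a < b -> ts_partition T a b P -> (i <= size P)%N ->
  ts_itv T a b (nth b (a :: P) i).
Proof.
move=> Ta ab [_ PS] iP.
have : nth b (a :: P) i \in a :: P by exact: mem_nth.
rewrite inE => /orP[/eqP ->|/PS//].
by split => //=; rewrite lexx ltW.
Qed.

Lemma ts_partition_nth_le (R : realType) (T : set R) (a b : R) (P : seq R)
    i j : ts_partition T a b P -> (i <= j)%N -> (j <= size P)%N ->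
  nth b (a :: P) i <= nth b (a :: P) j.
Proof.
move=> [[aP _] _] ij jP; apply: le_sorted_leq_nth => //.
  exact: (sub_path (@ltW _ _) aP).
by rewrite inE /= ltnS (leq_trans ij).
Qed.

Lemma selection_itv (R : realType) (T : set R) (a b : R) (P : seq R) x i :
  T a -> a < b -> ts_partition T a b P -> selection T a b P x ->
  (i < size P)%N -> ts_itv T a b (x i) /\ x i < b.
Proof.
move=> Ta ab Pp xP iP; have [/andP[lx xl] Tx] := xP _ iP.
have [/= /andP[al _] _] := ts_partition_node Ta ab Pp (ltnW iP).
have [/= /andP[_ lb] _] := ts_partition_node Ta ab Pp iP.
have xb := lt_le_trans xl lb.
by split=> //; split=> //=; rewrite (le_trans al lx) ltW.
Qed.

(** * The integral as a limit along refinements *)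

(** Sets of pairs (partition, selection) because the four integrals are to be
approached by sums over the same points. *)
Definition tagged_refinements (R : realType) (T : set R) (a b : R)
    (P0 : seq R) : set (seq R * (nat -> R)) :=
  [set Px | [/\ ts_partition T a b Px.1, {subset P0 <= Px.1} &
                selection T a b Px.1 Px.2]].

Definition refinement_filter (R : realType) (T : set R) (a b : R) :
    set_system (seq R * (nat -> R)) :=
  filter_from (ts_partition T a b) (tagged_refinements T a b).

(** Two partitions have a common refinement, obtained by sorting their union;
the left endpoints of the intervals provide a selection. *)
Lemma refinement_filter_proper (R : realType) (T : set R) (a b : R) :
  T a -> T b -> a < b -> ProperFilter (refinement_filter T a b).
Proof.
move=> Ta Tb ab; apply: filter_from_proper; last first.
  move=> P Pp; exists (P, nth b (a :: P)); split=> //= i iP.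
  have [_ Ti] := ts_partition_node Ta ab Pp (ltnW iP).
  have [[aP _] _] := Pp.
  have aPi := @lt_sorted_ltn_nth _ _ b (a :: P) aP i i.+1.
  by split=> //; rewrite lexx aPi ?inE //= ltnS ltnW.
apply: filter_from_filter => [|P Q Pp Qp].
  exists [:: b]; split; first exact: itv_partition1.
  by move=> t; rewrite inE => /eqP ->; split=> //=; rewrite lexx ltW.
have PQp : ts_partition T a b (sort <=%R (undup (P ++ Q))).
  apply: ts_partition_sort => [t|].
    rewrite mem_cat => /orP[tP|tQ]; split.
    - by case: Pp => _; apply.
    - exact: ts_partition_gt Pp tP.
    - by case: Qp => _; apply.
    - exact: ts_partition_gt Qp tQ.
  by rewrite mem_cat (ts_partition_mem_end ab Pp).
exists (sort <=%R (undup (P ++ Q))) => // -[U x] [/= Up sU xU].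
by split; split=> //= t tP; apply: sU; rewrite mem_sort mem_undup mem_cat tP ?orbT.
Qed.

(** Fine enough partitions contain any prescribed point of the time scale as a
node. *)
Lemma refinement_filterP (R : realType) (T : set R) (a b : R) :
  T b -> a < b -> forall t, ts_itv T a b t ->
  \forall Px \near refinement_filter T a b,
    [/\ ts_partition T a b Px.1, selection T a b Px.1 Px.2 & t \in a :: Px.1].
Proof.
move=> Tb ab t St.
have Sb : ts_itv T a b b by split=> //=; rewrite lexx ltW.
(* The lists of nodes leave out [a], so [t] is dropped when it equals [a]. *)
pose L := [seq s <- [:: t; b] | a < s].
have memL s : (s \in L) = (a < s) && ((s == t) || (s == b)).
  by rewrite mem_filter !inE.
exists (sort <=%R (undup L)).
  apply: ts_partition_sort => [s|]; last by rewrite memL ab eqxx orbT.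
  by rewrite memL => /andP[as_ /orP[]/eqP es]; split=> //; rewrite es.
move=> [P x] [/= Pp sP xP]; split=> //=; rewrite inE.
have [/= /andP[+ _] _] := St; rewrite le_eqVlt => /orP[/eqP->|at_].
  by rewrite eqxx.
by rewrite sP ?orbT // mem_sort mem_undup memL at_ eqxx.
Qed.

Lemma RS_delta_integral_cvgP (R : realType) (T : set R) (a b : R)
    (f g : R -> R) (I : R) : T a -> T b -> a < b ->
  is_RS_delta_integral T a b f g I <->
  RS_sum a b f g Px.1 Px.2 @[Px --> refinement_filter T a b] --> I.
Proof.
move=> Ta Tb ab; have FF := refinement_filter_proper Ta Tb ab.
rewrite cvgrPdist_lt; split=> fI e e0.
  have [P0 P0p P0I] := fI e e0; exists P0 => // -[P x] [/= Pp sP xP].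
  by rewrite distrC; apply: P0I.
have [P0 P0p P0I] := fI e e0; exists P0 => // P Pp sP x xP.
by rewrite distrC; apply: (P0I (P, x)); split.
Qed.

Lemma RS_delta_integral_lim (R : realType) (T : set R) (a b : R)
    (f g : R -> R) : T a -> T b -> a < b -> RS_delta_integrable T a b f g ->
  RS_sum a b f g Px.1 Px.2 @[Px --> refinement_filter T a b] -->
  RS_delta_integral T a b f g.
Proof.
move=> Ta Tb ab [_ _ _ fI].
by apply/RS_delta_integral_cvgP => //; apply: (getPex fI).
Qed.

(** When [t] is a node, [t <= x_i] holds exactly for the intervals that begin
at [t] or later, whatever the selection: the increments of [g] over them
telescope. *)
Lemma RS_sum_step (R : realType) (T : set R) (a b : R) (g : R -> R) P x t :
  ts_partition T a b P -> selection T a b P x -> t \in a :: P ->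
  RS_sum a b (fun s => (t <= s)%R%:R) g P x = g b - g t.
Proof.
move=> Pp xP /(nthP b)[k]; rewrite /= ltnS => kP tE.
have xk i : (i < size P)%N -> (t <= x i) = (k <= i)%N.
  move=> iP; have [/andP[lx xl] _] := xP _ iP; rewrite -tE.
  case: leqP => ki.
    by rewrite (le_trans _ lx) // (ts_partition_nth_le Pp) // ltnW.
  by apply/negbTE; rewrite -ltNge (lt_le_trans xl) // (ts_partition_nth_le Pp).
rewrite /RS_sum (big_cat_nat _ kP) //= big_nat big1 ?add0r; last first.
  move=> i /andP[_ ik]; rewrite xk ?(leq_trans ik) // leqNgt ik /=.
  by rewrite mul0r.
rewrite (eq_big_nat _ _
  (F2 := fun i => g (nth b (a :: P) i.+1) - g (nth b (a :: P) i))); last first.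
  by move=> i /andP[ki iP]; rewrite xk // ki mul1r.
rewrite (telescope_sumr (fun i => g (nth b (a :: P) i))) // tE.
by case: Pp => Pi _; rewrite (itv_partition_nth_size b Pi).
Qed.

Lemma step_RS_cvg (R : realType) (T : set R) (a b : R) (g : R -> R) t :
  T a -> T b -> a < b -> ts_itv T a b t ->
  RS_sum a b (fun s => (t <= s)%R%:R) g Px.1 Px.2
    @[Px --> refinement_filter T a b] --> g b - g t.
Proof.
move=> Ta Tb ab St; have FF := refinement_filter_proper Ta Tb ab.
have FP := refinement_filterP Tb ab St.
apply: cvg_near_cst; apply: filterS FP.
by move=> [P x] [Pp xP tP]; exact: RS_sum_step Pp xP tP.
Qed.

Lemma RS_increment_ge0 (R : realType) (T : set R) (a b : R) (g : R -> R) P i :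
  T a -> a < b -> nondecreasing_on (ts_itv T a b) g -> ts_partition T a b P ->
  (i < size P)%N -> 0 <= g (nth b (a :: P) i.+1) - g (nth b (a :: P) i).
Proof.
move=> Ta ab g_nd Pp iP; rewrite subr_ge0; apply: g_nd.
- by apply/mem_set/ts_partition_node => //; apply: ltnW.
- by apply/mem_set/ts_partition_node.
- exact: ts_partition_nth_le Pp _ _.
Qed.

(** The indicator of [[a, oo[], which is 1 at every selected point, expresses
[g b - g a] as the sum of the non-negative increments of [g].  The values at [b]
do not enter since no selected point equals [b]. *)
Lemma RS_sum_dist (R : realType) (T : set R) (a b : R) (f h g : R -> R) e P x :
  T a -> a < b -> nondecreasing_on (ts_itv T a b) g ->
  (forall t, ts_itv T a b t -> t < b -> `|f t - h t| <= e) ->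
  ts_partition T a b P -> selection T a b P x ->
  `|RS_sum a b f g P x - RS_sum a b h g P x| <= e * (g b - g a).
Proof.
move=> Ta ab g_nd fh Pp xP; rewrite /RS_sum -sumrB.
apply: le_trans (ler_norm_sum _ _ _) _.
have -> : g b - g a = RS_sum a b (fun s => (a <= s)%R%:R) g P x.
  by rewrite (RS_sum_step _ Pp xP) // mem_head.
rewrite mulr_sumr big_nat [leRHS]big_nat; apply: ler_sum => i /andP[_ iP].
have [Sx xb] := selection_itv Ta ab Pp xP iP.
have [/= /andP[ax _] _] := Sx.
have D0 := RS_increment_ge0 Ta ab g_nd Pp iP.
by rewrite ax mul1r -mulrBl normrM (ger0_norm D0) ler_wpM2r // fh.
Qed.

(** * Rd-continuous functions *)

Lemma rd_continuousM (R : realType) (S : set R) (f1 f2 : R -> R) :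
  rd_continuous S f1 -> rd_continuous S f2 ->
  rd_continuous S (fun t => f1 t * f2 t).
Proof.
move=> [f1r f1l] [f2r f2l]; split=> t tS.
  by apply: cvgM; [apply: f1r|apply: f2r].
have [l1 fl1] := f1l _ tS; have [l2 fl2] := f2l _ tS.
by exists (l1 * l2); apply: cvgM.
Qed.

(** Either [t] is right-dense and [f] is continuous there, or [t] is isolated on
the right and [t] is the only point of [S] in a short interval [[t, t + d[]. *)
Lemma rd_continuous_right (R : realType) (S : set R) (f : R -> R) t e :
  rd_continuous S f -> S t -> 0 < e ->
  exists2 d, 0 < d & forall x, S x -> t <= x < t + d -> `|f x - f t| <= e.
Proof.
move=> [fr _] St e0.
have scattered d : 0 < d -> (forall x, S x -> t < x -> t + d <= x) ->
    exists2 d, 0 < d & forall x, S x -> t <= x < t + d -> `|f x - f t| <= e.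
  move=> d0 Sd; exists d => // x Sx /andP[]; rewrite le_eqVlt => /orP[/eqP <-|tx].
    by rewrite subrr normr0 ltW.
  by rewrite ltNge Sd.
have [Snt|Snt] := pselect (S `&` [set s | t < s] !=set0); last first.
  by apply: (scattered 1) => // x Sx tx; exfalso; apply: Snt; exists x.
have lbt : lbound (S `&` [set s | t < s]) t by move=> x [_ /ltW].
have hlb : has_lbound (S `&` [set s | t < s]) by exists t.
have := lb_le_inf Snt lbt; rewrite le_eqVlt => /orP[/eqP tE|tlt]; last first.
  apply: (scattered (inf (S `&` [set s | t < s]) - t)); first by rewrite subr_gt0.
  by move=> x Sx tx; rewrite addrC subrK; apply: ge_inf.
have /fr/cvgrPdist_lt/(_ _ e0) : right_dense S t by split.
rewrite near_withinE => /nbhs_ballP[d /= d0 fd]; exists d => // x Sx /andP[tx xd].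
rewrite distrC ltW // fd // /ball /= distrC ger0_norm ?subr_ge0 //.
by rewrite ltrBlDl.
Qed.

(** Either [t] is left-dense and [f] has a left limit, which serves as [l], or
some []t - d, t[] contains no point of [S]. *)
Lemma rd_continuous_left (R : realType) (S : set R) (f : R -> R) t e :
  rd_continuous S f -> S t -> 0 < e ->
  exists2 d, 0 < d &
    exists l, forall x, S x -> t - d < x < t -> `|f x - l| <= e.
Proof.
move=> [_ fl] St e0.
have scattered d : 0 < d -> (forall x, S x -> x < t -> x <= t - d) ->
    exists2 d, 0 < d &
      exists l, forall x, S x -> t - d < x < t -> `|f x - l| <= e.
  move=> d0 Sd; exists d => //; exists 0 => x Sx /andP[+ xt].
  by rewrite ltNge Sd.
have [Snt|Snt] := pselect (S `&` [set s | s < t] !=set0); last first.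
  by apply: (scattered 1) => // x Sx tx; exfalso; apply: Snt; exists x.
have ubt : ubound (S `&` [set s | s < t]) t by move=> x [_ /ltW].
have hub : has_ubound (S `&` [set s | s < t]) by exists t.
have := ge_sup Snt ubt; rewrite le_eqVlt => /orP[/eqP tE|tlt]; last first.
  apply: (scattered (t - sup (S `&` [set s | s < t]))); first by rewrite subr_gt0.
  by move=> x Sx xt; rewrite opprB addrC subrK; apply: ub_le_sup.
have /fl[l /cvgrPdist_lt/(_ _ e0)] : left_dense S t by split.
rewrite near_withinE near_withinE => /nbhs_ballP[d /= d0 fd].
exists d => //; exists l => x Sx /andP[dx xt].
rewrite distrC ltW // fd // /ball /= gtr0_norm ?subr_gt0 //.
by rewrite ltrBlDr -ltrBlDl.
Qed.

Lemma closed_inf_mem (R : realType) (A : set R) :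
  closed A -> A !=set0 -> has_lbound A -> A (inf A).
Proof.
move=> cA A0 lA; apply: cA => B /nbhs_ballP[e /= e0 eB].
have [x Ax xe] := inf_adherent e0 (conj A0 lA).
exists x; split=> //; apply: eB; rewrite /ball /= distrC ger0_norm.
  by rewrite ltrBlDl.
by rewrite subr_ge0; apply: ge_inf.
Qed.

Lemma closed_ts_itv (R : realType) (T : set R) (a b : R) :
  closed T -> closed (ts_itv T a b).
Proof.
move=> cT; apply: closedI => //.
rewrite (_ : [set t | _] = [set` `[a, b]%R]); first exact: itv_closed.
by apply/seteqP; split=> t /=; rewrite in_itv.
Qed.

(** The supremum of the points where [Q] holds belongs to the time scale,
satisfies [Q] by the leftward hypothesis, and would not be an upper bound
if it were less than [b].  The rightward hypothesis treats dense and scattered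
points alike: [s] is any later point for which all points of the time scale in
[[t, s[] are within [d] of [t]. *)
Lemma ts_itv_induction (R : realType) (T : set R) (a b : R) (Q : R -> Prop) :
  closed T -> T a -> T b -> a < b ->
  Q a ->
  (forall t, ts_itv T a b t -> exists2 d, 0 < d &
     forall s, ts_itv T a b s -> t - d < s < t -> Q s -> Q t) ->
  (forall t, ts_itv T a b t -> exists2 d, 0 < d &
     forall s, ts_itv T a b s -> t < s ->
       (forall x, ts_itv T a b x -> t <= x < s -> x < t + d) -> Q t -> Q s) ->
  Q b.
Proof.
move=> cT Ta Tb ab Qa Ql Qr; set S := ts_itv T a b in Ql Qr *.
have cS : closed S := @closed_ts_itv _ _ _ _ cT.
have Sa : S a by split=> //=; rewrite lexx ltW.
have Sb : S b by split=> //=; rewrite lexx ltW.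
pose A := [set t | S t /\ Q t].
have supA : has_sup A.
  by split; [exists a|exists b => t [[/= /andP[]]]].
pose c := sup A.
have Sc : S c.
  apply: cS; apply: (closure_subset (B := S)) (closure_sup supA.1 supA.2).
  by move=> t [].
have Qc : Q c.
  have [d d0 dQ] := Ql _ Sc.
  have [s [Ss Qs] cs] := sup_adherent d0 supA.
  have := sup_upper_bound supA (conj Ss Qs).
  rewrite le_eqVlt => /orP[/eqP sc|sc]; first by rewrite /c -sc.
  by apply: (dQ s) => //; rewrite cs.
have := Sc.1 => /= /andP[_]; rewrite le_eqVlt => /orP[/eqP <- //|cb].
have [d d0 dQ] := Qr _ Sc.
(* The next point to reach is [b] if it is closer than [d], and otherwise the
first point of the time scale at distance at least [d] after [c]. *)
suff [s [Ss cs scd]] : exists s, [/\ S s, c < s &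
    forall x, S x -> c <= x < s -> x < c + d].
  have Qs : Q s by apply: dQ.
  by have := sup_upper_bound supA (conj Ss Qs); rewrite leNgt cs.
have [bd|bd] := ltP b (c + d).
  by exists b; split=> // x _ /andP[_ xb]; apply: lt_trans bd.
pose B := S `&` [set t | c + d <= t].
have lB : has_lbound B by exists (c + d) => x [].
have cB : closed B by apply: closedI => //; apply: closed_ge.
have B0 : B !=set0 by exists b.
have [SB /= dB] := closed_inf_mem cB B0 lB.
exists (inf B); split=> //; first by rewrite (lt_le_trans _ dB) // ltrDl.
move=> x Sx /andP[_]; rewrite !ltNge; apply: contra => dx.
exact: ge_inf.
Qed.

(** Step functions on [[a, c[] are extended from [c] to [d] by a constant [v];
the invariant that they vanish from [c] on turns this into adding
[v] times the indicator of [[c, d[], a difference of two integrable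
indicators. *)
Lemma rd_continuous_approx (R : realType) (T : set R) (a b : R)
    (f g : R -> R) e :
  closed T -> T a -> T b -> a < b -> rd_continuous (ts_itv T a b) f -> 0 < e ->
  exists h : R -> R,
    [/\ exists I, RS_sum a b h g Px.1 Px.2 @[Px --> refinement_filter T a b]
          --> (I : R),
        exists M, forall t, `|h t| <= M &
        forall t, ts_itv T a b t -> t < b -> `|f t - h t| <= e].
Proof.
move=> cT Ta Tb ab f_rd e0; have FF := refinement_filter_proper Ta Tb ab.
pose Q c := exists h : R -> R,
    [/\ exists I, RS_sum a b h g Px.1 Px.2 @[Px --> refinement_filter T a b]
          --> (I : R),
        exists M, forall t, `|h t| <= M,
        forall t, c <= t -> h t = 0 &
        forall t, ts_itv T a b t -> t < c -> `|f t - h t| <= e].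
have extend c d v : ts_itv T a b c -> ts_itv T a b d -> c <= d ->
    (forall x, ts_itv T a b x -> c <= x < d -> `|f x - v| <= e) -> Q c -> Q d.
  move=> Sc Sd cd fv [h [[I hI] [M hM] h0 fh]].
  exists (fun t => h t + v * ((c <= t)%R%:R - (d <= t)%R%:R)); split.
  - exists (I + v * ((g b - g c) - (g b - g d))).
    rewrite (_ : (fun Px => _) = (fun Px : seq R * (nat -> R) =>
        RS_sum a b h g Px.1 Px.2 +
        v * (RS_sum a b (fun s => (c <= s)%R%:R) g Px.1 Px.2 -
             RS_sum a b (fun s => (d <= s)%R%:R) g Px.1 Px.2))).
      apply: cvgD => //; apply: cvgM; first exact: cvg_cst.
      by apply: cvgB; apply: step_RS_cvg.
    apply/funext => Px; rewrite /RS_sum -sumrB mulr_sumr -big_split /=.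
    by apply: eq_bigr => i _; ring.
  - exists (M + `|v| * (1 + 1)) => t.
    rewrite (le_trans (ler_normD _ _)) // lerD // normrM ler_wpM2l //.
    rewrite (le_trans (ler_normB _ _)) // lerD // ger0_norm // ?ler0n // lern1;
      by case: (_ <= _).
  - by move=> t dt; rewrite (le_trans cd dt) dt subrr mulr0 addr0 h0 // (le_trans cd).
  - move=> t St td; rewrite [d <= t]leNgt td subr0.
    have [ct|tc] := leP c t; last by rewrite mulr0 addr0 fh.
    by rewrite h0 // mulr1 add0r fv // ct.
suff [h [hI hM _ fh]] : Q b by exists h.
apply: (@ts_itv_induction _ T a) => //.
- exists (fun=> 0); split.
  + exists 0; rewrite (_ : (fun=> _) = fun=> 0); first exact: cvg_cst.
    by apply/funext => Px; rewrite /RS_sum big1 // => i _; rewrite mul0r.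
  + by exists 0 => t; rewrite normr0.
  + by [].
  + by move=> t [/= /andP[+ _] _]; rewrite leNgt => /negbTE ->.
- move=> t St; have [d d0 [l dl]] := rd_continuous_left f_rd St e0.
  exists d => // s Ss /andP[ds st]; apply: (extend _ _ l) => //; first exact: ltW.
  by move=> x Sx /andP[sx xt]; apply: dl => //; rewrite (lt_le_trans ds).
- move=> t St; have [d d0 dr] := rd_continuous_right f_rd St e0.
  exists d => // s Ss ts sd; apply: (extend _ _ (f t)) => //; first exact: ltW.
  move=> x Sx txs; apply: dr => //; rewrite (sd _ Sx txs) andbT.
  by case/andP: txs.
Qed.

Lemma rd_continuous_bounded (R : realType) (T : set R) (a b : R) (f : R -> R) :
  closed T -> T a -> T b -> a < b -> rd_continuous (ts_itv T a b) f ->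
  [bounded f t | t in ts_itv T a b].
Proof.
move=> cT Ta Tb ab f_rd.
have [h [_ [M hM] fh]] := rd_continuous_approx (fun=> 0) cT Ta Tb ab f_rd ltr01.
rewrite /bounded_near; near=> N => t St /=.
have [tb|bt] := ltP t b.
  apply: (@le_trans _ _ (1 + M)); last by near: N; apply: nbhs_pinfty_ge; exact: num_real.
  rewrite -(subrK (h t) (f t)) (le_trans (ler_normD _ _)) // lerD //.
  exact: fh.
have -> : t = b.
  by apply/eqP; rewrite eq_le bt andbT; case: St => /= /andP[].
by near: N; apply: nbhs_pinfty_ge; exact: num_real.
Unshelve. all: by end_near. Qed.

Lemma nondecreasing_on_bounded (R : realType) (T : set R) (a b : R)
    (g : R -> R) :
  T a -> T b -> a < b -> nondecreasing_on (ts_itv T a b) g ->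
  [bounded g t | t in ts_itv T a b].
Proof.
move=> Ta Tb ab g_nd.
have Sa : ts_itv T a b a by split=> //=; rewrite lexx ltW.
have Sb : ts_itv T a b b by split=> //=; rewrite lexx ltW.
rewrite /bounded_near; near=> N => t St /=; have [/= /andP[at_ tb] _] := St.
have gat : g a <= g t by apply: g_nd => //; exact: mem_set.
have gtb : g t <= g b by apply: g_nd => //; exact: mem_set.
apply: (@le_trans _ _ (`|g a| + `|g b|)); last first.
  by near: N; apply: nbhs_pinfty_ge; exact: num_real.
rewrite ler_norml.
have := ler_norm (g b); have := lerNnormlW (lexx `|g a|).
have := normr_ge0 (g a); have := normr_ge0 (g b).
by move=> *; apply/andP; split; lra.
Unshelve. all: by end_near. Qed.

(** Completeness of the reals: once a partition is fine enough for the sums of an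
integrable [h] that is uniformly close to [f], the sums of [f] stay near the
integral of [h]. *)
Lemma rd_continuous_RS_integrable (R : realType) (T : set R) (a b : R)
    (f g : R -> R) :
  closed T -> T a -> T b -> a < b -> rd_continuous (ts_itv T a b) f ->
  nondecreasing_on (ts_itv T a b) g -> RS_delta_integrable T a b f g.
Proof.
move=> cT Ta Tb ab f_rd g_nd; have FF := refinement_filter_proper Ta Tb ab.
split=> //; [exact: rd_continuous_bounded|exact: nondecreasing_on_bounded|].
suff /cvg_ex[I fI] : cvg (RS_sum a b f g Px.1 Px.2
    @[Px --> refinement_filter T a b]).
  by exists I; apply/RS_delta_integral_cvgP.
apply/cauchy_cvgP/cauchyP => e e0.
have Sa : ts_itv T a b a by split=> //=; rewrite lexx ltW.
have Sb : ts_itv T a b b by split=> //=; rewrite lexx ltW.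
have D0 : 0 <= g b - g a.
  by rewrite subr_ge0; apply: g_nd; [exact: mem_set..|exact: ltW].
(* The summand 1 keeps the denominator positive when [g] is constant. *)
pose e' := e / (2 * (g b - g a + 1)).
have e'0 : 0 < e' by rewrite divr_gt0 // mulr_gt0 // ltr_wpDl.
have e'D : e' * (g b - g a) <= e / 2.
  rewrite /e' invfM mulrA -mulrA ler_piMr ?divr_ge0 ?ltW //.
  by rewrite ltr_pdivrMl ?mulr1 ?ltrDl // ltr_wpDl.
have [h [[I hI] _ fh]] := rd_continuous_approx g cT Ta Tb ab f_rd e'0.
exists I; move/cvgrPdist_lt: hI => /(_ _ (divr_gt0 e0 (ltr0n _ 2))) hI.
apply: filterS2 hI (refinement_filterP Tb ab Sb) => -[P x] /= hI [Pp xP _].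
have fhP := RS_sum_dist Ta ab g_nd fh Pp xP.
rewrite /ball /= [e]splitr -(subrK (RS_sum a b h g P x) I) -addrA.
rewrite (le_lt_trans (ler_normD _ _)) // ltr_leD // distrC.
exact: le_trans fhP e'D.
Qed.

(** * Chebyshev's inequality *)

Lemma chebyshev_identity (R : comRingType) n (w u v : nat -> R) :
  ((\sum_(0 <= i < n) w i) * (\sum_(0 <= i < n) w i * u i * v i) -
   (\sum_(0 <= i < n) w i * u i) * (\sum_(0 <= i < n) w i * v i)) *+ 2 =
  \sum_(0 <= i < n) \sum_(0 <= j < n)
    w i * w j * ((u i - u j) * (v i - v j)).
Proof.
set A := \sum_(_ <= i < _) w i; set B := \sum_(_ <= i < _) _ * u i * v i.
set C := \sum_(_ <= i < _) _ * u i; set D := \sum_(_ <= i < _) _ * v i.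
have -> : (A * B - C * D) *+ 2 = (A * B - C * D) + (B * A - D * C) by ring.
rewrite !big_distrlr -!sumrB -big_split /=; apply: eq_bigr => i _.
by rewrite -!sumrB -big_split /=; apply: eq_bigr => j _; ring.
Qed.

(** The sign [s] covers at once similarly ordered ([s = 1]) and oppositely
ordered ([s = -1]) sequences. *)
Lemma chebyshev_sum (R : realDomainType) n (w u v : nat -> R) (s : R) :
  (forall i, (i < n)%N -> 0 <= w i) ->
  (forall i j, (i < n)%N -> (j < n)%N ->
     0 <= s * ((u i - u j) * (v i - v j))) ->
  0 <= s * ((\sum_(0 <= i < n) w i) * (\sum_(0 <= i < n) w i * u i * v i) -
            (\sum_(0 <= i < n) w i * u i) * (\sum_(0 <= i < n) w i * v i)).
Proof.
move=> w0 uv; rewrite -(pmulrn_lge0 _ (isT : (0 < 2)%N)) -mulrnAr.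
rewrite chebyshev_identity mulr_sumr big_nat sumr_ge0 // => i /andP[_ ni].
rewrite mulr_sumr big_nat sumr_ge0 // => j /andP[_ nj].
by rewrite mulrCA; apply: mulr_ge0; [apply: mulr_ge0; exact: w0|exact: uv].
Qed.

Lemma chebyshev_RS_delta_integral (R : realType) (T : set R) (a b : R)
    (p g f1 f2 : R -> R) (s : R) :
  T a -> T b -> a < b -> (forall t, ts_itv T a b t -> 0 <= p t) ->
  RS_delta_integrable T a b p g ->
  RS_delta_integrable T a b (fun t => p t * f1 t * f2 t) g ->
  RS_delta_integrable T a b (fun t => p t * f1 t) g ->
  RS_delta_integrable T a b (fun t => p t * f2 t) g ->
  (forall t r, ts_itv T a b t -> ts_itv T a b r ->
     0 <= s * ((f1 t - f1 r) * (f2 t - f2 r))) ->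
  0 <= s * (RS_delta_integral T a b p g *
            RS_delta_integral T a b (fun t => p t * f1 t * f2 t) g -
            RS_delta_integral T a b (fun t => p t * f1 t) g *
            RS_delta_integral T a b (fun t => p t * f2 t) g).
Proof.
move=> Ta Tb ab p0 pI p12I p1I p2I f12.
have FF := refinement_filter_proper Ta Tb ab.
have [_ _ g_nd _] := pI.
have L := RS_delta_integral_lim Ta Tb ab.
have lim : s * (RS_sum a b p g Px.1 Px.2 *
                RS_sum a b (fun t => p t * f1 t * f2 t) g Px.1 Px.2 -
                RS_sum a b (fun t => p t * f1 t) g Px.1 Px.2 *
                RS_sum a b (fun t => p t * f2 t) g Px.1 Px.2)
    @[Px --> refinement_filter T a b] -->
    s * (RS_delta_integral T a b p g *
         RS_delta_integral T a b (fun t => p t * f1 t * f2 t) g -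
         RS_delta_integral T a b (fun t => p t * f1 t) g *
         RS_delta_integral T a b (fun t => p t * f2 t) g).
  apply: cvgM; first exact: cvg_cst.
  by apply: cvgB; apply: cvgM; exact: L.
apply: cvgr_to_ge lim _.
have Sb : ts_itv T a b b by split=> //=; rewrite lexx ltW.
have FP := refinement_filterP Tb ab Sb.
apply: filterS FP => -[P x] [/= Pp xP _].
pose w i := p (x i) * (g (nth b (a :: P) i.+1) - g (nth b (a :: P) i)).
have wE h : RS_sum a b (fun t => p t * h t) g P x =
    \sum_(0 <= i < size P) w i * h (x i).
  by apply: eq_bigr => i _; rewrite /w mulrAC.
have -> : RS_sum a b (fun t => p t * f1 t * f2 t) g P x =
    \sum_(0 <= i < size P) w i * f1 (x i) * f2 (x i).
  by apply: eq_bigr => i _; rewrite /w; ring.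
rewrite !wE; apply: (chebyshev_sum (w := w) (u := f1 \o x) (v := f2 \o x)).
  move=> i iP; have [Sx _] := selection_itv Ta ab Pp xP iP.
  by rewrite mulr_ge0 ?p0 // (RS_increment_ge0 Ta ab g_nd Pp).
move=> i j iP jP; apply: f12.
  by have [] := selection_itv Ta ab Pp xP iP.
by have [] := selection_itv Ta ab Pp xP jP.
Qed.

Theorem proposition17 (R : realType) (T : set R) (a b : R)
    (p g f1 f2 : R -> R)
    (T_ts : time_scale T) (Ta : T a) (Tb : T b) (ab : a < b)
    (p_rd : rd_continuous (ts_itv T a b) p)
    (p_ge0 : forall t, ts_itv T a b t -> 0 <= p t)
    (g_nd : nondecreasing_on (ts_itv T a b) g)
    (f1_rd : rd_continuous (ts_itv T a b) f1)
    (f2_rd : rd_continuous (ts_itv T a b) f2) :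
  [/\ RS_delta_integrable T a b p g,
      RS_delta_integrable T a b (fun t => p t * f1 t * f2 t) g,
      RS_delta_integrable T a b (fun t => p t * f1 t) g &
      RS_delta_integrable T a b (fun t => p t * f2 t) g] /\
  (similarly_ordered (ts_itv T a b) f1 f2 ->
     RS_delta_integral T a b p g *
     RS_delta_integral T a b (fun t => p t * f1 t * f2 t) g >=
     RS_delta_integral T a b (fun t => p t * f1 t) g *
     RS_delta_integral T a b (fun t => p t * f2 t) g) /\
  (oppositely_ordered (ts_itv T a b) f1 f2 ->
     RS_delta_integral T a b p g *
     RS_delta_integral T a b (fun t => p t * f1 t * f2 t) g <=
     RS_delta_integral T a b (fun t => p t * f1 t) g *
     RS_delta_integral T a b (fun t => p t * f2 t) g).
Proof.
have cT := T_ts.2.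
have rdI f : rd_continuous (ts_itv T a b) f -> RS_delta_integrable T a b f g.
  by move=> f_rd; apply: rd_continuous_RS_integrable.
have pI := rdI _ p_rd.
have p1_rd := rd_continuousM p_rd f1_rd.
have p1I := rdI _ p1_rd.
have p2I := rdI _ (rd_continuousM p_rd f2_rd).
have p12I := rdI _ (rd_continuousM p1_rd f2_rd).
have cheb s := @chebyshev_RS_delta_integral _ _ _ _ _ _ _ _ s
  Ta Tb ab p_ge0 pI p12I p1I p2I.
split=> //; split=> f12.
  have := cheb 1; rewrite mul1r subr_ge0; apply=> t r St Sr.
  by rewrite mul1r f12.
have := cheb (-1); rewrite mulN1r oppr_ge0 subr_le0; apply=> t r St Sr.
by rewrite mulN1r oppr_ge0 f12.
Qed.
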